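(* Consider a power system with $n \ge 3$ generators as described in the context, let $\mathcal{I} = \{\mathcal{I}_\ell\}_{\ell=1}^{\hat n}$ be an arbitrary partition of $\mathcal{G} = \{1,\dots,n\}$, and let $M \in \mathcal{S}_{\mathrm{cl}}$. Then the power system is strongly synchronized with respect to $\mathcal{I}$ if and only if $D \in \mathcal{S}_{\mathrm{cl}}$, $f \in \mathcal{X}_{\mathrm{cl}}$, $E \in \mathcal{X}_{\mathrm{cl}}$, and $\Gamma \in \mathcal{S}_{\mathrm{cl}}$.
   Context: Power system. Let $n \ge 1$, $\bar n \ge 0$, $\mathcal{G} = \{1,\dots,n\}$ (generators and their generator buses), $\overline{\mathcal{G}} = \{n+1,\dots,n+\bar n\}$ (non-generator buses). Given are constants $M_i > 0$, $D_i \ge 0$, $f_i \in \mathbb{R}$, $E_i > 0$, $\chi_i > 0$ for $i \in \mathcal{G}$, and a connected undirected graph on the buses $\mathcal{G} \cup \overline{\mathcal{G}}$ with a reactance $\chi_{ij} = \chi_{ji} > 0$ on each edge. Put $M = \mathrm{diag}(M_i)$, $D = \mathrm{diag}(D_i)$, $f = (f_i)$, $E = (E_i)$, $L_{\mathrm{D}} = \mathrm{diag}(\chi_1^{-1},\dots,\chi_n^{-1})$. Let $L \in \mathbb{R}^{(n+\bar n)\times(n+\bar n)}$ be the weighted graph Laplacian: for $i\neq j$, its $(i,j)$ entry is $-\chi_{ij}^{-1}$ if buses $i,j$ are adjacent and $0$ otherwise, and its diagonal entries make all row sums $0$. Partition $L = \begin{bmatrix} L_{11} & L_{12} \\ L_{12}^{\mathsf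 T} & L_{22}\end{bmatrix}$ according to $\mathcal{G}, \overline{\mathcal{G}}$ (if $\bar n = 0$, read $L_{11} - L_{12}L_{22}^{-1}L_{12}^{\mathsf T}$ as $L_{11}$). The unknowns are the generator phases $\delta(t) \in \mathbb{R}^n$ and the complex bus voltages $\mathbf{V}_{\mathcal{G}}(t) = [V_i(t)(\cos\theta_i(t) + \imath \sin\theta_i(t))]_{i \in \mathcal{G}} \in \mathbb{C}^n$ and $\mathbf{V}_{\overline{\mathcal{G}}}(t) \in \mathbb{C}^{\bar n}$, where $V_i(t)$, $\theta_i(t)$ are voltage amplitude and phase. With $\mathbf{E}_{\mathcal{G}}(t) = [E_i(\cos\delta_i(t) + \imath\sin\delta_i(t))]_{i\in\mathcal{G}}$, the power system is the differential-algebraic system, $t \ge 0$, $$M\ddot\delta(t) + D\dot\delta(t) = f - \Big[\tfrac{E_iV_i(t)}{\chi_i}\sin(\delta_i(t)-\theta_i(t))\Big]_{i\in\mathcal{G}}, \qquad \begin{bmatrix} L_{\mathrm{D}}(\mathbf{E}_{\mathcal{G}}(t) - \mathbf{V}_{\mathcal{G}}(t)) \\ 0\end{bmatrix} = \begin{bmatrix} L_{11} & L_{12} \\ L_{12}^{\mathsf T} & L_{22}\end{bmatrix}\begin{bmatrix}\mathbf{V}_{\mathcal{G}}(t)\\ \mathbf{V}_{\overline{\mathcal{G}}}(t)\end{bmatrix}.$$ Set $\Gamma = L_{\mathrm{D}}(L_{\mathrm{D}} + L_{11} - L_{12}L_{22}^{-1}L_{12}^{\mathsf T})^{-1}L_{\mathrm{D}}$,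 which is positive definite with positive entries. The system is equivalent to the Kron-reduced form $M_i\ddot\delta_i + D_i\dot\delta_i = f_i - \sum_{k=1}^n \Gamma_{ik}E_iE_k\sin(\delta_i-\delta_k)$, $i\in\mathcal{G}$, together with $L_{\mathrm{D}}\mathbf{V}_{\mathcal{G}}(t) = \Gamma\mathbf{E}_{\mathcal{G}}(t)$ and $\mathbf{V}_{\overline{\mathcal{G}}}(t) = -L_{22}^{-1}L_{12}^{\mathsf T}\mathbf{V}_{\mathcal{G}}(t)$. Notation. $\mathcal{X}_{ij} = \{x \in \mathbb{R}^n : x_i = x_j\}$; for a complex vector $x \in \mathbb{C}^n$, ''$x\in\mathcal{X}_{ij}$'' likewise means $x_i = x_j$. $\Pi_{ij}$ is the $n\times n$ permutation matrix of the transposition of $i$ and $j$ (identity if $i=j$), and $\mathcal{S}_{ij} = \{A \in \mathbb{R}^{n\times n} : A\Pi_{ij} = \Pi_{ij}A\}$. For a partition $\mathcal{I} = \{\mathcal{I}_\ell\}_{\ell=1}^{\hat n}$ of $\mathcal{G}$ into nonempty disjoint clusters, $\mathcal{X}_{\mathrm{cl}} = \bigcap_{\ell}\bigcap_{i,j\in\mathcal{I}_\ell}\mathcal{X}_{ij}$ and $\mathcal{S}_{\mathrm{cl}} = \bigcap_{\ell}\bigcap_{i,j\in\mathcal{I}_\ell}\mathcal{S}_{ij}$. Definition. The $i$th and $j$th generators are synchronized if, for every initial condition $\delta(0),\dot\delta(0)\in\mathcal{X}_{ij}$, the solution satisfies $\delta(t)\in\mathcal{X}_{ij}$ and $\mathbf{V}_{\mathcal{G}}(t)\in\mathcal{X}_{ij}$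 for all $t\ge0$. The power system is strongly synchronized with respect to $\mathcal{I}$ if the $i$th and $j$th generators are synchronized for all $i,j\in\mathcal{I}_\ell$ and all $\ell$. *)

(* Defs.v *)
From mathcomp Require Import all_boot all_order all_algebra all_fingroup.
From mathcomp Require Import all_classical all_reals all_analysis.
From mathcomp Require Import complex.

Set Implicit Arguments.
Unset Strict Implicit.
Unset Printing Implicit Defensive.

Import Order.TTheory GRing.Theory Num.Theory.
Import numFieldNormedType.Exports.

Local Open Scope classical_set_scope.
Local Open Scope ring_scope.
Local Open Scope complex_scope.

(* Indices are shifted: generators (and generator buses) are 'I_n; the buses
   are 'I_(n + nbar), of which the first n are the generator buses.
   Only the values of bus_reactance on adjacent pairs are meaningful. *)
Record power_system (R : realType) (n nbar : nat) := PowerSystem {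
  inertia : 'I_n -> R;
  damping : 'I_n -> R;
  power_input : 'cV[R]_n;
  emf : 'cV[R]_n;
  gen_reactance : 'I_n -> R;
  adjacent : rel 'I_(n + nbar);
  bus_reactance : 'I_(n + nbar) -> 'I_(n + nbar) -> R;
  inertia_gt0 : forall i, 0 < inertia i;
  damping_ge0 : forall i, 0 <= damping i;
  emf_gt0 : forall i, 0 < emf i 0;
  gen_reactance_gt0 : forall i, 0 < gen_reactance i;
  adjacent_sym : symmetric adjacent;
  adjacent_irr : irreflexive adjacent;
  adjacent_connected : forall i j, connect adjacent i j;
  bus_reactance_sym : forall i j,
    adjacent i j -> bus_reactance i j = bus_reactance j i;
  bus_reactance_gt0 : forall i j, adjacent i j -> 0 < bus_reactance i j
}.

Section SystemMatrices.
Variables (R : realType) (n nbar : nat) (P : power_system R n nbar).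

Definition inertia_mx : 'M[R]_n := diag_mx (\row_i inertia P i).

Definition damping_mx : 'M[R]_n := diag_mx (\row_i damping P i).

Definition LD_mx : 'M[R]_n := diag_mx (\row_i (gen_reactance P i)^-1).

Definition edge_weight (i j : 'I_(n + nbar)) : R :=
  if adjacent P i j then (bus_reactance P i j)^-1 else 0.

Definition laplacian : 'M[R]_(n + nbar) :=
  \matrix_(i, j) if i == j then \sum_(k | k != i) edge_weight i k
                 else - edge_weight i j.

(* For nbar = 0 the product through the empty block vanishes, so this is
   L11 in that case. *)
Definition kron_reduced : 'M[R]_n :=
  let L11 := ulsubmx laplacian in
  let L12 := ursubmx laplacian in
  let L22 := drsubmx laplacian in
  L11 - L12 *m invmx L22 *m L12^T.

Definition Gamma : 'M[R]_n := LD_mx *m invmx (LD_mx + kron_reduced) *m LD_mx.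

End SystemMatrices.

(* Right-sided derivative at t = 0, usual two-sided derivative at t > 0. *)
Definition has_derivative_on_ge0 (R : realType) (g : R -> R) (t l : R) : Prop :=
  h^-1 * (g (t + h) - g t) @[h --> within [set h | 0 <= t + h] 0^'] --> l.

(* The vector of a_i (cos phi_i + i sin phi_i). *)
Definition polar (R : realType) (n : nat) (a phi : 'cV[R]_n) : 'cV[R[i]]_n :=
  \col_i ((a i 0 * cos (phi i 0)) +i* (a i 0 * sin (phi i 0))).

(* Only the values at times t >= 0 are meaningful. *)
Record trajectory (R : realType) (n nbar : nat) := Trajectory {
  phase : R -> 'cV[R]_n;
  frequency : R -> 'cV[R]_n;
  acceleration : R -> 'cV[R]_n;
  amplitude : R -> 'cV[R]_n;
  angle : R -> 'cV[R]_n;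
  nongen_voltage : R -> 'cV[R[i]]_nbar
}.

Definition gen_voltage (R : realType) (n nbar : nat) (x : trajectory R n nbar)
    (t : R) : 'cV[R[i]]_n :=
  polar (amplitude x t) (angle x t).

Definition internal_voltage (R : realType) (n nbar : nat)
    (P : power_system R n nbar) (x : trajectory R n nbar) (t : R) :
    'cV[R[i]]_n :=
  polar (emf P) (phase x t).

Record is_solution (R : realType) (n nbar : nat) (P : power_system R n nbar)
    (x : trajectory R n nbar) : Prop := IsSolution {
  phase_deriv : forall (t : R) i, 0 <= t ->
    has_derivative_on_ge0 (fun s => phase x s i 0) t (frequency x t i 0);
  frequency_deriv : forall (t : R) i, 0 <= t ->
    has_derivative_on_ge0 (fun s => frequency x s i 0) t
      (acceleration x t i 0);
  amplitude_ge0 : forall (t : R) i, 0 <= t -> 0 <= amplitude x t i 0;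
  swing_equation : forall t : R, 0 <= t ->
    inertia_mx P *m acceleration x t + damping_mx P *m frequency x t =
    power_input P -
    \col_i (emf P i 0 * amplitude x t i 0 / gen_reactance P i *
            sin (phase x t i 0 - angle x t i 0));
  network_equation : forall t : R, 0 <= t ->
    col_mx (map_mx (real_complex R) (LD_mx P) *m
              (internal_voltage P x t - gen_voltage x t)) 0 =
    map_mx (real_complex R) (laplacian P) *m
      col_mx (gen_voltage x t) (nongen_voltage x t)
}.

Definition Xset (K : Type) (n : nat) (i j : 'I_n) : set 'cV[K]_n :=
  [set x | x i ord0 = x j ord0].

Definition Sset (R : realType) (n : nat) (i j : 'I_n) : set 'M[R]_n :=
  [set A | A *m tperm_mx i j = tperm_mx i j *m A].

Definition Xcl (K : Type) (n : nat) (I : {set {set 'I_n}}) : set 'cV[K]_n :=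
  [set x | forall (C : {set 'I_n}) (i j : 'I_n),
    C \in I -> i \in C -> j \in C -> Xset i j x].

Definition Scl (R : realType) (n : nat) (I : {set {set 'I_n}}) : set 'M[R]_n :=
  [set A | forall (C : {set 'I_n}) (i j : 'I_n),
    C \in I -> i \in C -> j \in C -> Sset i j A].

Definition synchronized (R : realType) (n nbar : nat)
    (P : power_system R n nbar) (i j : 'I_n) : Prop :=
  forall x : trajectory R n nbar, is_solution P x ->
    Xset i j (phase x 0) -> Xset i j (frequency x 0) ->
    forall t : R, 0 <= t -> Xset i j (phase x t) /\ Xset i j (gen_voltage x t).

Definition strongly_synchronized (R : realType) (n nbar : nat)
    (P : power_system R n nbar) (I : {set {set 'I_n}}) : Prop :=
  forall (C : {set 'I_n}) (i j : 'I_n),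
    C \in I -> i \in C -> j \in C -> synchronized P i j.

(* Main.v *)
Require Import Defs.
From mathcomp Require Import all_boot all_order all_algebra all_fingroup.
From mathcomp Require Import all_classical all_reals all_analysis.
From mathcomp Require Import complex ring lra.

(* Eliminating the voltages turns the network equation into
   L_D V = Gamma E and the dynamics into the Kron-reduced swing equation, whose
   vector field is globally Lipschitz, so every initial state starts a global
   solution.  Necessity: along a synchronized solution phases, frequencies,
   accelerations and voltages of i and j agree at t = 0; evaluating the
   difference of the two swing equations and of the two voltage equations at
   delta = 0 and at delta = (pi / 2) e_k, k <> i, j, gives linear relations
   between rows i and j of Gamma, which force symmetry because the rows of
   Gamma sum to 1 / chi, Gamma is invertible, and the Kron-reduced Laplacian
   has only the constants in its kernel.  Sufficiency: the phase difference
   satisfies a second-order linear differential inequality with zero initial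
   data, hence vanishes. *)

Set Implicit Arguments.
Unset Strict Implicit.
Unset Printing Implicit Defensive.

Import Order.TTheory GRing.Theory Num.Theory.
Import numFieldNormedType.Exports.

Local Open Scope classical_set_scope.
Local Open Scope ring_scope.

(** * Calculus on the half-line *)

Section HalfLineCalculus.
Variable R : realType.
Implicit Types (f g : R -> R) (t : R).

Let ge0_dnbhs_filter t : Filter (within [set h : R | 0 <= t + h] 0^').
Proof. exact: within_filter. Qed.
#[local] Existing Instance ge0_dnbhs_filter.

(** Small positive increments are admissible even at [t = 0]; properness is what makes the one-sided
    derivative unique. *)
Lemma ge0_dnbhs_proper t : 0 <= t ->
  ProperFilter (within [set h : R | 0 <= t + h] 0^').
Proof.
move=> t0; apply: Build_ProperFilter_ex => A.
move=> /(nbhs_ballP _ _) [e /= e0 H].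
exists (e / 2); apply: H => /=.
- by rewrite /ball/= sub0r normrN gtr0_norm ?divr_gt0// ltr_pdivrMr// ltr_pMr// ltr1n.
- by rewrite gt_eqF// divr_gt0.
- by rewrite addr_ge0// ltW// divr_gt0.
Qed.

Lemma has_derivative_on_ge0_unique g t a b : 0 <= t ->
  has_derivative_on_ge0 g t a -> has_derivative_on_ge0 g t b -> a = b.
Proof.
move=> t0 ga gb; have PF := ge0_dnbhs_proper t0.
exact: (cvg_unique _ ga gb).
Qed.

Lemma has_derivative_on_ge0_ext f g t a : 0 <= t ->
  (forall s, 0 <= s -> f s = g s) ->
  has_derivative_on_ge0 f t a -> has_derivative_on_ge0 g t a.
Proof.
move=> t0 fg; apply: cvg_trans; apply: near_eq_cvg.
near=> h; rewrite !fg//.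
by near: h; exact: withinT.
Unshelve. all: by end_near. Qed.

Lemma is_derive_has_derivative_on_ge0 g t a :
  is_derive t 1 g a -> has_derivative_on_ge0 g t a.
Proof.
move=> [dg <-]; apply: cvg_within_filter.
have -> : (fun h : R => h^-1 * (g (t + h) - g t)) =
   (fun h : R => h^-1 *: (g (h *: (1 : R) + t) - g t)).
  by apply/funext => h; rewrite /GRing.scale/= mulr1 (addrC h).
exact: dg.
Qed.

Lemma has_derivative_on_ge0_is_derive g t a : 0 < t ->
  has_derivative_on_ge0 g t a -> is_derive t 1 g a.
Proof.
move=> t0 gt.
have H : (fun h : R => h^-1 *: (g (h *: (1 : R) + t) - g t)) @ 0^' --> a.
  have -> : (fun h : R => h^-1 *: (g (h *: (1 : R) + t) - g t)) =
     (fun h : R => h^-1 * (g (t + h) - g t)).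
    by apply/funext => h; rewrite /GRing.scale/= mulr1 (addrC h).
  move=> A /gt; move=> /(nbhs_ballP _ _)[e/= e0 H].
  (* Increments smaller than [t] keep [t + h] nonnegative, so the restriction of the filter is
     void. *)
  apply/nbhs_ballP; exists (Num.min e t) => /=; first by rewrite lt_min e0.
  move=> h; rewrite /ball/= sub0r normrN lt_min => /andP[he ht] h0.
  apply: H => //=; first by rewrite /ball/= sub0r normrN.
  by move: ht; rewrite ltr_norml => /andP[]; rewrite -subr_gt0; lra.
apply: DeriveDef; last exact/cvg_lim.
by apply/cvg_ex; exists a.
Qed.

Lemma has_derivative_on_ge0_cvg g t a : has_derivative_on_ge0 g t a ->
  g (t + h) @[h --> within [set h | 0 <= t + h] 0^'] --> g t.
Proof.
move=> gt.
have H0 : (h : R) @[h --> within [set h | 0 <= t + h] 0^'] --> (0 : R).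
  by apply: cvg_within_filter; apply: cvg_within_filter; exact: cvg_id.
rewrite -[X in _ --> X](_ : 0 * a + g t = _); last by rewrite mul0r add0r.
refine (cvg_trans _ (cvgD (cvgM H0 gt) (cvg_cst (g t)))).
apply: near_eq_cvg.
near=> h; rewrite !fctE /= mulrA divff ?mul1r ?subrK//.
near: h; apply: cvg_within; exact: withinT.
Unshelve. all: by end_near. Qed.

Lemma has_derivative_on_ge0B f g t a b : has_derivative_on_ge0 f t a ->
  has_derivative_on_ge0 g t b -> has_derivative_on_ge0 (f \- g) t (a - b).
Proof.
move=> fa gb; refine (cvg_trans _ (cvgB fa gb)); apply: near_eq_cvg.
by near=> h; rewrite !fctE /=; ring.
Unshelve. all: by end_near. Qed.

Lemma has_derivative_on_ge0D f g t a b : has_derivative_on_ge0 f t a ->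
  has_derivative_on_ge0 g t b -> has_derivative_on_ge0 (f \+ g) t (a + b).
Proof.
move=> fa gb; refine (cvg_trans _ (cvgD fa gb)); apply: near_eq_cvg.
by near=> h; rewrite !fctE /=; ring.
Unshelve. all: by end_near. Qed.

Lemma has_derivative_on_ge0M f g t a b : has_derivative_on_ge0 f t a ->
  has_derivative_on_ge0 g t b ->
  has_derivative_on_ge0 (f \* g) t (a * g t + f t * b).
Proof.
move=> fa gb; have gc := has_derivative_on_ge0_cvg gb.
refine (cvg_trans _ (cvgD (cvgM fa gc) (cvgM (cvg_cst (f t)) gb))).
apply: near_eq_cvg.
by near=> h; rewrite !fctE /=; ring.
Unshelve. all: by end_near. Qed.

(** On the open half-line the derivative is two-sided and its sign gives monotonicity; right
    continuity at [0] adds the endpoint. *)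
Lemma has_derivative_on_ge0_le g (g' : R -> R) :
  (forall t : R, 0 <= t -> has_derivative_on_ge0 g t (g' t)) ->
  (forall t, 0 < t -> 0 <= g' t) ->
  forall t : R, 0 <= t -> g 0 <= g t.
Proof.
move=> dg g'0 t t0.
have D (x : R) : x \in `]0, +oo[ -> is_derive x 1 g (g' x).
  rewrite in_itv/= andbT => x0.
  by apply: has_derivative_on_ge0_is_derive => //; exact/dg/ltW.
apply: (@ger0_derive1_ndecry _ g 0) => // [x /D[]//|x x0|].
  rewrite derive1E; have [_ ->] := D _ x0; apply: g'0.
  by move: x0; rewrite in_itv/= andbT.
apply/continuous_within_itvcyP; split.
  by move=> x /D[/derivable1_diffP/differentiable_continuous].
have := has_derivative_on_ge0_cvg (dg 0 (lexx _)).
move=> H A /H; move=> /(nbhs_ballP _ _)[e/= e0 {}H].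
apply/nbhs_ballP; exists e => //= h he h0.
by have := H h he; rewrite /= add0r; apply; rewrite ?ltW ?gt_eqF.
Qed.

Lemma has_derivative_on_ge0_expR c t :
  has_derivative_on_ge0 (fun s => expR (c * s)) t (c * expR (c * t)).
Proof.
apply: is_derive_has_derivative_on_ge0.
have D : is_derive t 1 (fun s : R => c * s) c.
  have := @is_deriveZ R R^o R^o id c t 1 1 (is_derive_id _ _).
  by rewrite /GRing.scale/= mulr1.
have := @is_derive1_comp R expR (fun s => c * s) t _ _ (is_derive_expR _) D.
by rewrite mulrC.
Qed.

(** Adding [g] to, or subtracting it from, [A / c * expR (c * t)] gives functions with nonnegative
    derivative that start at [A / c >= 0]. The division by [c] is the source of the contraction in
    the Picard iteration. *)
Lemma exp_bounded_derivative g (g' : R -> R) (A c : R) : 0 < c ->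
  g 0 = 0 -> (forall t : R, 0 <= t -> has_derivative_on_ge0 g t (g' t)) ->
  (forall t : R, 0 <= t -> `|g' t| <= A * expR (c * t)) ->
  forall t : R, 0 <= t -> `|g t| <= A / c * expR (c * t).
Proof.
move=> c0 g0 dg bg t t0.
have A0 : 0 <= A.
  by have := bg 0 (lexx _); rewrite mulr0 expR0 mulr1; apply: le_trans.
pose k (s : R) := A / c.
have dk (s : R) : has_derivative_on_ge0 k s 0.
  by apply: is_derive_has_derivative_on_ge0; exact: is_derive_cst.
have dE s := has_derivative_on_ge0M (dk s) (@has_derivative_on_ge0_expR c s).
have E0 : 0 <= k 0 * expR (c * 0) by rewrite mulr_ge0 ?expR_ge0// divr_ge0// ltW.
have Ec s : 0 * expR (c * s) + k s * (c * expR (c * s)) = A * expR (c * s).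
  by rewrite mul0r add0r mulrA /k divfK ?gt_eqF.
rewrite ler_norml; apply/andP; split.
- have := has_derivative_on_ge0_le
    (fun s s0 => has_derivative_on_ge0D (dE s) (dg s s0)) _ t0.
  rewrite /= g0 addr0 => H; rewrite -subr_ge0 opprK addrC.
  apply: (le_trans E0); apply: H => s s0; rewrite Ec.
  by have := bg s (ltW s0); rewrite ler_norml => /andP[]; lra.
- have := has_derivative_on_ge0_le
    (fun s s0 => has_derivative_on_ge0B (dE s) (dg s s0)) _ t0.
  rewrite /= g0 subr0 => H; rewrite -subr_ge0.
  apply: (le_trans E0); apply: H => s s0; rewrite Ec.
  by have := bg s (ltW s0); rewrite ler_norml => /andP[]; lra.
Qed.

Lemma antiderivative_on_ge0 g : continuous g -> exists G : R -> R,
  [/\ continuous G, forall t : R, t <= 0 -> G t = 0 &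
      forall t : R, 0 <= t -> has_derivative_on_ge0 G t (g t)].
Proof.
move=> cg.
(* Integrating from [-1] makes [0] an interior point for the fundamental theorem of calculus. *)
pose H (x : R) := (\int[lebesgue_measure]_(s in `[-1, x]) g s)%R.
have dH (x : R) : 0 <= x -> is_derive x 1 H (g x).
  move=> x0.
  have [||||h1 h2] := @continuous_FTC1 R g (BLeft (-1)) x (x + 1).
  - by rewrite ltrDl.
  - apply: continuous_compact_integrable; first exact: segment_compact.
    exact: continuous_subspaceT.
  - by rewrite lte_fin; lra.
  - exact: cg.
  - by apply: DeriveDef => //; rewrite -derive1E.
(* Truncating the argument at [0] makes [G] vanish at negative times while staying continuous on the
   whole line. *)
pose G x := H (Num.max x 0) - H 0.
exists G; split.
- move=> x; rewrite /G; apply: cvgB; last exact: cvg_cst.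
  have m0 : 0 <= Num.max x 0 by rewrite le_max lexx orbT.
  have [/derivable1_diffP/differentiable_continuous cH _] := dH _ m0.
  apply: (@continuous_comp _ _ _ (fun x : R => Num.max x 0) H) => //.
  by apply: continuous_max; [exact: cvg_id|exact: cvg_cst].
- by move=> x x0; rewrite /G max_r// subrr.
- move=> t t0; apply: (@has_derivative_on_ge0_ext (H \- cst (H 0))) => //.
    by move=> s s0; rewrite /G max_l.
  rewrite -[g t]subr0; apply: has_derivative_on_ge0B.
    exact/is_derive_has_derivative_on_ge0/dH.
  by apply: is_derive_has_derivative_on_ge0; exact: is_derive_cst.
Qed.

End HalfLineCalculus.

(** * Global solutions of Lipschitz differential equations *)

Section Picard.
Variables (R : realType) (S : finType) (F : (S -> R) -> S -> R) (K : R).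
Hypothesis K_gt0 : 0 < K.
(** Lipschitz condition for the supremum norm, phrased with any common bound [e] on the
    coordinates. *)
Hypothesis F_lipschitz : forall (u v : S -> R) e,
  (forall i, `|u i - v i| <= e) -> forall i, `|F u i - F v i| <= K * e.

Lemma lipschitz_field_continuous (u : S -> R -> R) :
  (forall i, continuous (u i)) ->
  forall i, continuous (fun t => F (u ^~ t) i).
Proof.
move=> cu i t; apply/cvgrPdist_le => e e0.
have eK : 0 < e / K by rewrite divr_gt0.
have H : \forall s \near t, forall j, `|u j t - u j s| <= e / K.
  apply: (@filter_forall _ _ (fun j s => `|u j t - u j s| <= e / K) (nbhs t)).
  move=> j.
  by have /cvgrPdist_le := cu j t; apply.
near=> s.
have Hs : forall j, `|u j t - u j s| <= e / K by near: s.
by rewrite (le_trans (F_lipschitz Hs i))// mulrC divfK// gt_eqF.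
Unshelve. all: by end_near. Qed.

(* Picard iterates x_k satisfy |x_(k+1) - x_k| <= A 2^-k e^(2Kt): integrating
   the Lipschitz bound K A 2^-k e^(2Ks) halves the constant, so the iterates
   converge locally uniformly on the whole half-line. *)
Theorem lipschitz_ode_solution (x0 : S -> R) : exists x : S -> R -> R,
  (forall i, x i 0 = x0 i) /\
  forall (t : R) i, 0 <= t -> has_derivative_on_ge0 (x i) t (F (x ^~ t) i).
Proof.
have [J JP] : {J : (R -> R) -> R -> R & forall g, continuous g ->
    [/\ continuous (J g), forall t : R, t <= 0 -> J g t = 0 &
     forall t : R, 0 <= t -> has_derivative_on_ge0 (J g) t (g t)]}.
  apply: (@choice _ _ (fun g G => continuous g -> [/\ continuous G,
    forall t : R, t <= 0 -> G t = 0 &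
    forall t : R, 0 <= t -> has_derivative_on_ge0 G t (g t)])) => g.
  (* A discontinuous [g] receives itself as a placeholder. *)
  have [cg|] := pselect (continuous g); last by exists g.
  by have [G GP] := antiderivative_on_ge0 cg; exists G.
(* This rate makes the contraction factor [K / c] equal to one half. *)
pose c := 2 * K.
have c0 : 0 < c by rewrite mulr_gt0.
pose T (u : S -> R -> R) i t := x0 i + J (fun s => F (u ^~ s) i) t.
have T_cont u : (forall i, continuous (u i)) -> forall i, continuous (T u i).
  move=> cu i t; apply: cvgD; first exact: cvg_cst.
  by have [+ _ _] := JP _ (lipschitz_field_continuous cu (i := i)); apply.
have T0 u : (forall i, continuous (u i)) -> forall i t, t <= 0 -> T u i t = x0 i.
  move=> cu i t t0; rewrite /T.
  have [_ + _] := JP _ (lipschitz_field_continuous cu (i := i)).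
  by move=> ->//; rewrite addr0.
(* [T] contracts in the norm weighted by [expR (c * t)]; for [t <= 0] both images are the initial
   value. *)
have T_diff u v B : (forall i, continuous (u i)) ->
    (forall i, continuous (v i)) ->
    (forall i t, `|u i t - v i t| <= B * expR (c * t)) ->
    forall i t, `|T u i t - T v i t| <= B / 2 * expR (c * t).
  move=> cu cv uv i t.
  have B0 : 0 <= B.
    by have := uv i 0; rewrite mulr0 expR0 mulr1; apply: le_trans.
  have [t0|t0] := leP t 0.
    by rewrite !T0// subrr normr0 mulr_ge0 ?expR_ge0// divr_ge0.
  have [_ Ju0 dJu] := JP _ (lipschitz_field_continuous cu (i := i)).
  have [_ Jv0 dJv] := JP _ (lipschitz_field_continuous cv (i := i)).
  rewrite /T [X in `|X|](_ : _ = (J (fun s => F (u ^~ s) i) \-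
    J (fun s => F (v ^~ s) i)) t); last by rewrite /=; ring.
  have -> : B / 2 = (K * B) / c by rewrite /c; field; rewrite gt_eqF.
  apply: (exp_bounded_derivative (g' := fun s => F (u ^~ s) i - F (v ^~ s) i)).
  - exact: c0.
  - by rewrite /= Ju0// Jv0// subrr.
  - by move=> s s0; apply: has_derivative_on_ge0B; [exact: dJu|exact: dJv].
  - move=> s s0; rewrite -mulrA.
    by apply: F_lipschitz => j; exact: uv.
  - exact: ltW.
pose x k := iter k T (fun i _ => x0 i).
have cx k i : continuous (x k i).
  elim: k i => [|k IH] i; first by move=> t; exact: cvg_cst.
  exact: T_cont.
(* The first increment has the constant derivative [F x0 i] for [t >= 0], which [A * c] bounds. *)
pose A := (\sum_i `|F x0 i|) / c.
have A0 : 0 <= A by rewrite divr_ge0 ?sumr_ge0// ltW.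
have x_step k i t : `|x k.+1 i t - x k i t| <= A / 2 ^+ k * expR (c * t).
  elim: k i t => [|k IH] i t; last first.
    by rewrite exprSr invfM mulrA; apply: (T_diff (x k.+1) (x k)).
  rewrite expr0 divr1 /x/=.
  have [t0|t0] := leP t 0.
    rewrite T0//; last by move=> j; exact: (cx 0).
    by rewrite subrr normr0; exact: mulr_ge0 A0 (expR_ge0 _).
  have [_ J0 dJ] := JP _ (lipschitz_field_continuous (cx 0) (i := i)).
  rewrite /T addrAC subrr add0r.
  apply: (exp_bounded_derivative (g' := fun s => F x0 i)) => //.
  - by rewrite J0.
  - move=> s s0; rewrite -[leLHS]mulr1; apply: ler_pM => //.
      by rewrite (bigD1 i)//= lerDl sumr_ge0.
    by rewrite -expR0 ler_expR mulr_ge0// ltW.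
  - exact: ltW.
have x_gap k p i t :
    `|x (k + p)%N i t - x k i t| <= 2 * A / 2 ^+ k * expR (c * t).
  (* The difference of powers is the exact sum of the geometric bounds of [x_step], so the induction
     on [p] closes. *)
  suff : `|x (k + p)%N i t - x k i t| <=
         2 * A * (2 ^- k - 2 ^- (k + p)) * expR (c * t).
    move/le_trans; apply; apply: ler_wpM2r; first exact: expR_ge0.
    apply: ler_wpM2l; first by rewrite mulr_ge0.
    by rewrite lerBlDr lerDl invr_ge0 exprn_ge0.
  elim: p => [|p IH]; first by rewrite addn0 !subrr normr0 mulr0 mul0r.
  rewrite addnS -(subrKA (x (k + p)%N i t)).
  apply: (le_trans (ler_normD _ _)).
  apply: (le_trans (lerD (x_step _ _ _) IH)).
  rewrite le_eqVlt; apply/orP; left; apply/eqP.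
  rewrite exprS; field.
  by rewrite !expf_neq0 ?pnatr_eq0.
have small (C e : R) : 0 <= C -> 0 < e -> exists k, C / 2 ^+ k < e.
  move=> C0 e0; exists (Num.bound (C / e)); rewrite ltr_pdivrMr ?exprn_gt0//.
  rewrite mulrC -ltr_pdivrMr//.
  apply: (lt_trans (archi_boundP _)); first by rewrite divr_ge0// ltW.
  by rewrite -natrX ltr_nat ltn_expl.
have x_cvg i t : cvgn (fun k => x k i t).
  apply/cauchy_cvgP/cauchy_exP => e e0.
  have [|k Hk] := small (2 * A * expR (c * t)) e _ e0.
    by rewrite mulr_ge0 ?expR_ge0// mulr_ge0.
  exists (x k i t); exists k => // m /= km; rewrite /ball/=.
  rewrite distrC -(subnKC km); apply: (le_lt_trans (x_gap _ _ _ _)).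
  by rewrite mulrAC.
pose y i t := limn (fun k => x k i t).
have y_gap k i t : `|y i t - x k i t| <= 2 * A / 2 ^+ k * expR (c * t).
  have H : (fun p => `|x p i t - x k i t|) @ \oo --> `|y i t - x k i t|.
    by apply: cvg_norm; apply: cvgB; [exact: x_cvg|exact: cvg_cst].
  rewrite -(cvg_lim (@Rhausdorff R) H); apply: limr_le; first exact: cvgP H.
  exists k => // m /= km.
  by rewrite -(subnKC km); exact: x_gap.
have cy i : continuous (y i).
  move=> t; apply/cvgrPdist_lt => e e0.
  have e3 : 0 < e / 3 by rewrite divr_gt0.
  have [|k Hk] := small (2 * A * expR (c * (t + 1))) (e / 3) _ e3.
    by rewrite mulr_ge0 ?expR_ge0// mulr_ge0.
  (* Monotonicity of the exponential makes the bound uniform for times up to [t + 1], so [y]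
     inherits continuity from one iterate. *)
  have Hy s : s <= t + 1 -> `|y i s - x k i s| < e / 3.
    move=> st; apply: (le_lt_trans (y_gap k i s)); apply: le_lt_trans Hk.
    rewrite mulrAC; apply: ler_wpM2r; first by rewrite invr_ge0 exprn_ge0.
    apply: ler_wpM2l; first by rewrite mulr_ge0.
    by rewrite ler_expR; apply: ler_wpM2l => //; exact: ltW.
  near=> s.
  have h1 : `|y i t - x k i t| < e / 3 by apply: Hy; rewrite lerDl.
  have h2 : `|y i s - x k i s| < e / 3.
    by apply: Hy; near: s; apply: lt_le_nbhsl; rewrite ltrDl.
  have h3 : `|x k i t - x k i s| < e / 3.
    near: s; have /cvgrPdist_lt := cx k i t; exact.
  move: h1 h2 h3; rewrite !ltr_norml => /andP[? ?] /andP[? ?] /andP[? ?].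
  by apply/andP; split; lra.
(* Both [y] and [T y] lie within [A / 2 ^+ k * expR (c * t)] of the iterate [x k.+1], for every
   [k]. *)
have Ty : y = T y.
  apply/funext => i; apply/funext => t; apply/eqP; rewrite -subr_eq0 -normr_le0.
  apply/ler_addgt0Pr => e e0; rewrite add0r.
  have [|k Hk] := small (3 * A * expR (c * t)) e _ e0.
    by rewrite mulr_ge0 ?expR_ge0// mulr_ge0.
  apply: le_trans (ltW Hk).
  rewrite -(subrKA (x k.+1 i t)); apply: (le_trans (ler_normD _ _)).
  have h1 := y_gap k.+1 i t.
  have h2 := T_diff _ _ _ cy (cx k) (y_gap k) i t.
  rewrite distrC in h2; apply: (le_trans (lerD h1 h2)).
  rewrite exprS invfM; move: (expR (c * t)) (expR_ge0 (c * t)) => E E0.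
  have q0 : 0 <= (2 ^+ k : R)^-1 by rewrite invr_ge0 exprn_ge0.
  move: (2 ^+ k : R)^-1 q0 => q q0.
  have AqE := mulr_ge0 (mulr_ge0 A0 q0) E0.
  by lra.
exists y; split=> [i|t i t0]; first by rewrite Ty T0.
have [_ _ /(_ _ t0) dJ] := JP _ (lipschitz_field_continuous cy (i := i)).
rewrite -[F _ _]add0r {1}Ty; apply: has_derivative_on_ge0D dJ.
by apply: is_derive_has_derivative_on_ge0; exact: is_derive_cst.
Unshelve. all: by end_near. Qed.

End Picard.

(** * Kron reduction *)

Lemma injective_unitmx (F : fieldType) m (A : 'M[F]_m) :
  (forall v : 'cV_m, A *m v = 0 -> v = 0) -> A \in unitmx.
Proof.
move=> Ainj; rewrite -unitmx_tr -row_free_unit; apply: inj_row_free => v vA.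
apply: trmx_inj; rewrite trmx0; apply: Ainj.
by apply: trmx_inj; rewrite trmx_mul trmxK trmx0.
Qed.

Section KronReduction.
Variables (R : realType) (n nbar : nat) (P : power_system R n nbar).
Notation L := (laplacian P).
Notation L11 := (ulsubmx (laplacian P)).
Notation L12 := (ursubmx (laplacian P)).
Notation L22 := (drsubmx (laplacian P)).
Notation LD := (LD_mx P).
Notation K := (kron_reduced P).
Notation w := (edge_weight P).

Lemma edge_weight_sym i j : w i j = w j i.
Proof.
rewrite /edge_weight adjacent_sym; case: ifP => // aji.
by rewrite bus_reactance_sym// adjacent_sym.
Qed.

Lemma edge_weight_ge0 i j : 0 <= w i j.
Proof.
rewrite /edge_weight; case: ifP => // aij.
by rewrite invr_ge0 ltW// bus_reactance_gt0.
Qed.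

Lemma edge_weight_gt0 i j : Defs.adjacent P i j -> 0 < w i j.
Proof. by move=> aij; rewrite /edge_weight aij invr_gt0 bus_reactance_gt0. Qed.

Lemma laplacian_mulE (x : 'cV[R]_(n + nbar)) i :
  (L *m x) i 0 = \sum_k w i k * (x i 0 - x k 0).
Proof.
rewrite mxE (bigD1 i)//= [RHS](bigD1 i)//= subrr mulr0 add0r mxE eqxx.
rewrite mulr_suml -big_split/=; apply: eq_bigr => k ki.
by rewrite mxE eq_sym (negPf ki) mulrBr mulNr.
Qed.

Lemma laplacian_tr : L^T = L.
Proof.
apply/matrixP => i j; rewrite !mxE eq_sym.
by case: eqP => [->//|_]; rewrite edge_weight_sym.
Qed.

(** This is the Dirichlet energy of the graph. Averaging the double sum with its copy where [i] and
    [k] are exchanged completes the squares; one half compensates for counting each edge twice. *)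
Lemma laplacian_form (x : 'cV[R]_(n + nbar)) :
  (x^T *m (L *m x)) 0 0 =
  2^-1 * \sum_i \sum_k w i k * (x i 0 - x k 0) ^+ 2.
Proof.
have E : (x^T *m (L *m x)) 0 0 =
    \sum_i \sum_k w i k * (x i 0 * (x i 0 - x k 0)).
  rewrite mxE; apply: eq_bigr => i _; rewrite laplacian_mulE mxE mulr_sumr.
  by apply: eq_bigr => k _; rewrite mulrCA.
have E' : (x^T *m (L *m x)) 0 0 =
    \sum_i \sum_k w i k * (x k 0 * (x k 0 - x i 0)).
  rewrite E exchange_big; apply: eq_bigr => i _; apply: eq_bigr => k _.
  by rewrite edge_weight_sym.
suff -> : \sum_i \sum_k w i k * (x i 0 - x k 0) ^+ 2 =
    (x^T *m (L *m x)) 0 0 + (x^T *m (L *m x)) 0 0.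
  by field.
rewrite {1}E {1}E' -big_split/=; apply: eq_bigr => i _.
by rewrite -big_split/=; apply: eq_bigr => k _; ring.
Qed.

Lemma laplacian_form_ge0 (x : 'cV[R]_(n + nbar)) :
  0 <= (x^T *m (L *m x)) 0 0.
Proof.
rewrite laplacian_form mulr_ge0//; apply: sumr_ge0 => i _.
by apply: sumr_ge0 => k _; rewrite mulr_ge0 ?sqr_ge0 ?edge_weight_ge0.
Qed.

(** Zero energy forces equality across every edge, and connectedness propagates it along paths. *)
Lemma laplacian_form_eq0 (x : 'cV[R]_(n + nbar)) :
  (x^T *m (L *m x)) 0 0 = 0 -> forall i j, x i 0 = x j 0.
Proof.
rewrite laplacian_form => /eqP; rewrite mulf_eq0 invr_eq0 pnatr_eq0/=.
have H i k : 0 <= w i k * (x i 0 - x k 0) ^+ 2.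
  by rewrite mulr_ge0 ?sqr_ge0 ?edge_weight_ge0.
rewrite psumr_eq0; last by move=> i _; exact: sumr_ge0.
move=> /allP x0.
have adj_eq i k : Defs.adjacent P i k -> x i 0 = x k 0.
  move=> aik; have := x0 i (mem_index_enum _); rewrite psumr_eq0//.
  move=> /allP/(_ k (mem_index_enum _)).
  by rewrite /= mulf_eq0 gt_eqF ?edge_weight_gt0//= sqrf_eq0 subr_eq0 => /eqP.
move=> i j; have /connectP[p] := adjacent_connected P i j.
elim: p i => [|k p IH] i /=; first by move=> _ ->.
by move=> /andP[/adj_eq -> kp] jp; exact: IH.
Qed.

Lemma laplacian_block : L = block_mx L11 L12 L12^T L22.
Proof. by rewrite trmx_ursub laplacian_tr submxK. Qed.

Lemma laplacian_const (c : R) : L *m const_mx c = 0 :> 'cV_(n + nbar).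
Proof.
apply/colP => i; rewrite laplacian_mulE [RHS]mxE big1// => k _.
by rewrite !mxE subrr mulr0.
Qed.

Lemma LD_diagE m (v : 'M[R]_(n, m)) i j :
  (LD *m v) i j = (gen_reactance P i)^-1 * v i j.
Proof. by rewrite mul_diag_mx !mxE. Qed.

Lemma LD_unit : LD \in unitmx.
Proof.
apply: injective_unitmx => v /colP v0; apply/colP => i.
have /eqP := v0 i; rewrite LD_diagE !mxE mulf_eq0 invr_eq0.
by rewrite gt_eqF ?gen_reactance_gt0//= => /eqP.
Qed.

(** * Elimination of the non-generator buses and properties of [Gamma] *)

Hypothesis n_gt0 : (0 < n)%N.

(** A kernel vector extended by zero to the generator buses has zero energy, hence is constant; its
    value at a generator bus, which exists as [n > 0], is zero. *)
Lemma L22_unit : L22 \in unitmx.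
Proof.
apply: injective_unitmx => v v0.
have xx0 : ((col_mx 0 v)^T *m (L *m col_mx (0 : 'cV_n) v)) 0 0 = 0.
  rewrite laplacian_block mul_block_col v0 !mulmx0 !add0r.
  by rewrite tr_col_mx mul_row_col trmx0 mul0mx mulmx0 addr0 mxE.
apply/colP => i.
have := laplacian_form_eq0 xx0 (rshift n i) (lshift nbar (Ordinal n_gt0)).
by rewrite col_mxEd col_mxEu !mxE.
Qed.

Lemma kron_tr : K^T = K.
Proof.
rewrite /kron_reduced/= linearB/= !trmx_mul trmxK trmx_inv mulmxA.
by rewrite trmx_ulsub trmx_drsub laplacian_tr.
Qed.

(** Extending [v] so that no current is injected at the other buses realizes the Schur complement
    [K] inside [L]. Sign and kernel properties of [L] thus descend to [K]. *)
Lemma kron_extension (v : 'cV[R]_n) :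
  L *m col_mx v (- (invmx L22 *m L12^T *m v)) = col_mx (K *m v) 0.
Proof.
rewrite [X in X *m _]laplacian_block mul_block_col; congr col_mx.
  by rewrite mulmxN /kron_reduced/= mulmxBl !mulmxA.
by rewrite mulmxN -mulmxA mulKVmx ?L22_unit// subrr.
Qed.

Lemma kron_form (v : 'cV[R]_n) (u := - (invmx L22 *m L12^T *m v)) :
  (v^T *m (K *m v)) 0 0 = ((col_mx v u)^T *m (L *m col_mx v u)) 0 0.
Proof. by rewrite kron_extension tr_col_mx mul_row_col mulmx0 addr0. Qed.

Lemma kron_ker_const (v : 'cV[R]_n) :
  K *m v = 0 -> forall i j, v i 0 = v j 0.
Proof.
move=> Kv i j; have := kron_form v; rewrite Kv mulmx0 mxE => /esym.
move=> /laplacian_form_eq0/(_ (lshift nbar i) (lshift nbar j)).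
by rewrite !col_mxEu.
Qed.

Lemma kron_const (c : R) : K *m const_mx c = 0 :> 'cV_n.
Proof.
have := laplacian_const c; rewrite -[const_mx c]vsubmxK; rewrite -col_mx_const.
rewrite laplacian_block mul_block_col -[0]vsubmxK => /eq_col_mx[].
rewrite col_mxKu col_mxKd !linear0 => h1 h2.
rewrite /kron_reduced/= mulmxBl -!mulmxA.
have -> : L12^T *m const_mx c = - (L22 *m const_mx c) :> 'cV_nbar.
  by apply/eqP; rewrite -addr_eq0 h2.
by rewrite mulmxN mulKmx ?L22_unit// mulmxN opprK.
Qed.

(** [LD] is positive definite and [K] positive semidefinite, so a kernel vector already has zero
    [LD] energy. *)
Lemma LD_kron_unit : LD + K \in unitmx.
Proof.
apply: injective_unitmx => v v0.
have : (v^T *m ((LD + K) *m v)) 0 0 = 0 by rewrite v0 mulmx0 mxE.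
rewrite mulmxDl mulmxDr mxE => /eqP.
have D i : 0 <= (gen_reactance P i)^-1 * v i 0 ^+ 2.
  by rewrite mulr_ge0 ?sqr_ge0// invr_ge0 ltW// gen_reactance_gt0.
have -> : (v^T *m (LD *m v)) 0 0 =
    \sum_i (gen_reactance P i)^-1 * v i 0 ^+ 2.
  by rewrite mxE; apply: eq_bigr => i _; rewrite LD_diagE mxE mulrCA expr2.
rewrite paddr_eq0; last 2 first.
- exact: sumr_ge0.
- by rewrite kron_form; exact: laplacian_form_ge0.
rewrite psumr_eq0// => /andP[/allP vv _]; apply/colP => i.
have := vv i (mem_index_enum _); rewrite /= mulf_eq0 invr_eq0.
by rewrite gt_eqF ?gen_reactance_gt0//= sqrf_eq0 mxE => /eqP.
Qed.

(** The lower block determines [u]; the upper one then reads [LD *m e = (LD + K) *m v] and is solved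
    for [v]. *)
Lemma network_equation_kron (e v : 'cV[R]_n) (u : 'cV[R]_nbar) :
  col_mx (LD *m (e - v)) 0 = L *m col_mx v u <->
  LD *m v = Gamma P *m e /\ u = - (invmx L22 *m L12^T *m v).
Proof.
have E : LD *m v = Gamma P *m e <-> LD *m e = (LD + K) *m v.
  rewrite /Gamma -!mulmxA; split=> [/(congr1 (mulmx (invmx LD)))|->].
    by rewrite !mulKmx ?LD_unit// => ->; rewrite mulKVmx ?LD_kron_unit.
  by rewrite mulKmx ?LD_kron_unit.
split=> [H|[/E LDe ->]]; last first.
  by rewrite kron_extension mulmxBr LDe mulmxDl addrC addKr.
have uE : u = - (invmx L22 *m L12^T *m v).
  move: H; rewrite {1}laplacian_block mul_block_col => /eq_col_mx[_ /esym/eqP].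
  rewrite addrC addr_eq0 => /eqP/(congr1 (mulmx (invmx L22))).
  by rewrite mulKmx ?L22_unit// mulmxN mulmxA.
split=> //; apply/E; move: H; rewrite uE kron_extension => /eq_col_mx[+ _].
by rewrite (mulmxDl LD K v) => <-; rewrite mulmxBr addrC subrK.
Qed.

Lemma Gamma_tr : (Gamma P)^T = Gamma P.
Proof.
have LDt : LD^T = LD by rewrite tr_diag_mx.
rewrite /Gamma !trmx_mul trmx_inv linearD/= kron_tr LDt.
by rewrite mulmxA.
Qed.

Lemma Gamma_unit : Gamma P \in unitmx.
Proof. by rewrite !unitmx_mul unitmx_inv LD_unit LD_kron_unit. Qed.

(** Cancelling invertible factors leaves [LD *m v = (LD + K) *m v]. Constant vectors give the row
    sums of [Gamma]; the indicator of a pair will be used to compare reactances. *)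
Lemma Gamma_fixE (v : 'cV[R]_n) : Gamma P *m v = LD *m v <-> K *m v = 0.
Proof.
have -> : Gamma P *m v = LD *m v <-> LD *m v = (LD + K) *m v.
  rewrite /Gamma -!mulmxA; split=> [/(congr1 (mulmx (invmx LD)))|E].
    rewrite !mulKmx ?LD_unit// => {2}<-.
    by rewrite mulKVmx ?LD_kron_unit.
  by rewrite {1}E mulKmx ?LD_kron_unit.
rewrite mulmxDl; split=> [/esym/eqP|->]; last by rewrite addr0.
by rewrite -subr_eq0 addrAC subrr add0r => /eqP.
Qed.

Lemma Gamma_row_sum i : \sum_k Gamma P i k = (gen_reactance P i)^-1.
Proof.
have /colP/(_ i) := (Gamma_fixE (const_mx 1)).2 (kron_const 1).
rewrite LD_diagE !mxE mulr1 => <-.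
by apply: eq_bigr => k _; rewrite [const_mx _ _ _]mxE mulr1.
Qed.

End KronReduction.

(** * Complex voltages and scalar estimates *)

Section ComplexParts.
Variable R : realType.

Lemma map_Re_mulmx p q r (A : 'M[R]_(p, q)) (z : 'M[R[i]%C]_(q, r)) :
  map_mx (@complex.Re R) (map_mx (real_complex R) A *m z) =
  A *m map_mx (@complex.Re R) z.
Proof.
apply/matrixP => i j; rewrite !mxE (big_morph (@complex.Re R) (id1 := 0)
  (op1 := +%R)) => [| [a b] [c d]|] //.
by apply: eq_bigr => k _; rewrite !mxE; case: (z k j) => a b /=; rewrite mul0r subr0.
Qed.

Lemma map_Im_mulmx p q r (A : 'M[R]_(p, q)) (z : 'M[R[i]%C]_(q, r)) :
  map_mx (@complex.Im R) (map_mx (real_complex R) A *m z) =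
  A *m map_mx (@complex.Im R) z.
Proof.
apply/matrixP => i j; rewrite !mxE (big_morph (@complex.Im R) (id1 := 0)
  (op1 := +%R)) => [| [a b] [c d]|] //.
by apply: eq_bigr => k _; rewrite !mxE; case: (z k j) => a b /=; rewrite mul0r addr0.
Qed.

Lemma map_ReIm_eq p q (z z' : 'M[R[i]%C]_(p, q)) :
  z = z' <-> map_mx (@complex.Re R) z = map_mx (@complex.Re R) z' /\
             map_mx (@complex.Im R) z = map_mx (@complex.Im R) z'.
Proof.
split=> [->//|[/matrixP zr /matrixP zi]]; apply/matrixP => i j.
apply/eqP; rewrite eq_complex; apply/andP; split; apply/eqP.
  by have := zr i j; rewrite !mxE.
by have := zi i j; rewrite !mxE.
Qed.

Lemma complex_network_equation n nbar (P : power_system R n nbar)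
    (e v : 'cV[R[i]%C]_n) (u : 'cV[R[i]%C]_nbar) (Re := @complex.Re R)
    (Im := @complex.Im R) :
  col_mx (map_mx (real_complex R) (LD_mx P) *m (e - v)) 0 =
    map_mx (real_complex R) (laplacian P) *m col_mx v u <->
  col_mx (LD_mx P *m (map_mx Re e - map_mx Re v)) 0 =
    laplacian P *m col_mx (map_mx Re v) (map_mx Re u) /\
  col_mx (LD_mx P *m (map_mx Im e - map_mx Im v)) 0 =
    laplacian P *m col_mx (map_mx Im v) (map_mx Im u).
Proof.
rewrite map_ReIm_eq !map_col_mx !map_Re_mulmx !map_Im_mulmx !map_col_mx.
have -> : map_mx Re (0 : 'cV_nbar) = 0 by apply/matrixP => i j; rewrite !mxE.
have -> : map_mx Im (0 : 'cV_nbar) = 0 by apply/matrixP => i j; rewrite !mxE.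
have -> : map_mx Re (e - v) = map_mx Re e - map_mx Re v.
  by apply/matrixP => i j; rewrite !mxE; case: (e i j) (v i j) => ? ? [].
have -> // : map_mx Im (e - v) = map_mx Im e - map_mx Im v.
by apply/matrixP => i j; rewrite !mxE; case: (e i j) (v i j) => ? ? [].
Qed.

Lemma polar_decomposition (x y : R) : exists a phi : R,
  [/\ 0 <= a, a * cos phi = x & a * sin phi = y].
Proof.
pose r := Num.sqrt (x ^+ 2 + y ^+ 2).
have s0 : 0 <= x ^+ 2 + y ^+ 2 by rewrite addr_ge0 ?sqr_ge0.
have r2 : r ^+ 2 = x ^+ 2 + y ^+ 2 by rewrite sqr_sqrtr.
have r0 : 0 <= r by exact: sqrtr_ge0.
have [rE|rN0] := eqVneq r 0.
  exists 0, 0; rewrite lexx !mul0r; move: r2; rewrite rE expr0n/= => /esym/eqP.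
  by rewrite paddr_eq0 ?sqr_ge0// !sqrf_eq0 => /andP[/eqP-> /eqP->].
have rp : 0 < r by rewrite lt_neqAle eq_sym rN0.
have xr : -1 <= x / r <= 1.
  rewrite -ler_norml normrM normfV (ger0_norm r0) ler_pdivrMr// mul1r.
  by rewrite -(@ler_pXn2r _ 2) ?nnegrE// -normrX ger0_norm ?sqr_ge0// r2 lerDl sqr_ge0.
have cE : r * cos (acos (x / r)) = x.
  by rewrite acosK ?in_itv//= mulrC divfK.
have sE : r * sin (acos (x / r)) = `|y|.
  apply/eqP; rewrite -(@eqrXn2 _ 2) ?mulr_ge0 ?sin_acos ?sqrtr_ge0//.
  have s1 : 0 <= 1 - (x / r) ^+ 2.
    by rewrite subr_ge0 -real_normK ?num_real// exprn_ile1// ler_norml.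
  rewrite exprMn (sqr_sqrtr s1).
  by rewrite -normrX ger0_norm ?sqr_ge0// mulrBr mulr1 exprMn exprVn mulrCA divff
    ?expf_neq0// mulr1 r2 addrAC subrr add0r.
(* [acos] only returns angles with nonnegative sine, so a negative [y] takes the opposite angle. *)
have [y0|y0] := leP 0 y.
  by exists r, (acos (x / r)); rewrite cE sE ger0_norm.
exists r, (- acos (x / r)); rewrite cosN sinN mulrN cE sE ltr0_norm//.
by rewrite opprK.
Qed.

Lemma sin_lipschitz (x y : R) : `|sin x - sin y| <= `|x - y|.
Proof.
wlog xy : x y / x <= y.
  by move=> H; have [/H//|/ltW/H] := leP x y; rewrite distrC (distrC y).
have [|z _ E] := @MVT_segment R sin cos x y xy.
  by apply: continuous_subspaceT => z; exact: continuous_sin.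
rewrite distrC E normrM (distrC x) -[leRHS]mul1r.
by apply: ler_wpM2r => //; exact: cos_max.
Qed.

(** A Gronwall argument for the energy [d ^+ 2 + w ^+ 2], to be applied to the phase difference of
    two generators. *)
Lemma second_order_zero (d w a : R -> R) (C : R) :
  (forall t : R, 0 <= t -> has_derivative_on_ge0 d t (w t)) ->
  (forall t : R, 0 <= t -> has_derivative_on_ge0 w t (a t)) ->
  (forall t : R, 0 <= t -> `|a t| <= C * (`|d t| + `|w t|)) ->
  d 0 = 0 -> w 0 = 0 -> forall t : R, 0 <= t -> d t = 0.
Proof.
move=> dd dw aC d0 w0 t t0.
wlog C0 : C aC / 0 <= C.
  move=> H; apply: (H (Num.max C 0)); last by rewrite le_max lexx orbT.
  move=> s s0; apply: (le_trans (aC s s0)); apply: ler_wpM2r.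
    by rewrite addr_ge0.
  by rewrite le_max lexx.
(* expR (c t) (d^2 + w^2) is nonincreasing for this rate c. *)
pose c := - (1 + 3 * C).
pose phi := (d \* d) \+ (w \* w).
have dphi s (s0 : 0 <= s) := has_derivative_on_ge0D
  (has_derivative_on_ge0M (dd s s0) (dd s s0))
  (has_derivative_on_ge0M (dw s s0) (dw s s0)).
have d0' s : has_derivative_on_ge0 (cst (0 : R)) s 0.
  by apply: is_derive_has_derivative_on_ge0; exact: is_derive_cst.
(* The weighted energy is subtracted from zero to turn its decrease into growth. *)
have dpsi s (s0 : 0 <= s) := has_derivative_on_ge0B (d0' s)
  (has_derivative_on_ge0M (@has_derivative_on_ge0_expR R c s) (dphi s s0)).
have := has_derivative_on_ge0_le dpsi _ t0.
rewrite /= d0 w0 !mulr0 addr0 mulr0 subr0 => H.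
have : phi t <= 0.
  have /H : forall s, 0 < s -> 0 <= 0 - (c * expR (c * s) *
      (d s * d s + w s * w s) + expR (c * s) * ((w s * d s + d s * w s) +
      (a s * w s + w s * a s))).
    move=> s /ltW s0; rewrite sub0r oppr_ge0.
    rewrite -mulrA (mulrCA c) -mulrDr; apply: mulr_ge0_le0; first exact: expR_ge0.
    have ha := aC s s0.
    have h1 : a s * w s <= C * (`|d s| + `|w s|) * `|w s|.
      by apply: (le_trans (ler_norm _)); rewrite normrM ler_wpM2r.
    have h2 : d s * w s <= `|d s| * `|w s| by rewrite -normrM ler_norm.
    have h3 : `|d s| ^+ 2 = d s * d s by rewrite -normrX ger0_norm ?sqr_ge0.
    have h4 : `|w s| ^+ 2 = w s * w s by rewrite -normrX ger0_norm ?sqr_ge0.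
    rewrite -h3 -h4; move: h1 h2.
    move: `|d s| `|w s| => D W h1 h2.
    (* These squares absorb the mixed products [D * W] and [C * D * W]. *)
    have h5 := sqr_ge0 (D - W).
    have h6 : 0 <= C * (D - W) ^+ 2 by rewrite mulr_ge0 ?sqr_ge0.
    have h7 : 0 <= C * D ^+ 2 by rewrite mulr_ge0 ?sqr_ge0.
    rewrite /c; nra.
  by rewrite sub0r oppr_ge0 pmulr_rle0// expR_gt0.
rewrite /phi/= => phi0; apply/eqP.
have := phi0; rewrite -!expr2 => {}phi0.
have : d t ^+ 2 == 0.
  by rewrite eq_le sqr_ge0 andbT (le_trans _ phi0)// lerDl sqr_ge0.
by rewrite sqrf_eq0.
Qed.

End ComplexParts.

(** * Solutions of the power system *)

Section Solutions.
Variables (R : realType) (n nbar : nat) (P : power_system R n nbar).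
Hypothesis n_gt0 : (0 < n)%N.
Notation G := (Gamma P).
Notation M := (inertia P).
Notation D := (damping P).
Notation f := (power_input P).
Notation E := (emf P).
Notation chi := (gen_reactance P).

Lemma generator_voltage_part (e v : 'cV[R]_n) :
  LD_mx P *m v = G *m e <->
  forall i, v i 0 = chi i * \sum_k G i k * e k 0.
Proof.
have chi0 i : chi i != 0 by rewrite gt_eqF ?gen_reactance_gt0.
split=> [/colP H i|H]; last apply/colP => i.
  by have := H i; rewrite LD_diagE [in RHS]mxE => <-; rewrite mulVKf.
by rewrite LD_diagE H mulKf// [in RHS]mxE.
Qed.

(** Quantifying over [u] eliminates the non-generator voltages; what remains are the real and
    imaginary parts of [L_D V = Gamma E], solved for [V]. *)
Lemma network_equation_polar (x : trajectory R n nbar) (t : R) :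
  (exists u : 'cV[R[i]%C]_nbar,
    col_mx (map_mx (real_complex R) (LD_mx P) *m
              (internal_voltage P x t - gen_voltage x t)) 0 =
    map_mx (real_complex R) (laplacian P) *m
      col_mx (gen_voltage x t) u) <->
  forall i,
    amplitude x t i 0 * cos (angle x t i 0) =
      chi i * \sum_k G i k * (E k 0 * cos (phase x t k 0)) /\
    amplitude x t i 0 * sin (angle x t i 0) =
      chi i * \sum_k G i k * (E k 0 * sin (phase x t k 0)).
Proof.
pose Re := @complex.Re R; pose Im := @complex.Im R.
have reE : map_mx Re (internal_voltage P x t) =
    \col_k (E k 0 * cos (phase x t k 0)) by apply/colP => k; rewrite !mxE.
have imE : map_mx Im (internal_voltage P x t) =
    \col_k (E k 0 * sin (phase x t k 0)) by apply/colP => k; rewrite !mxE.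
have reV : map_mx Re (gen_voltage x t) =
    \col_k (amplitude x t k 0 * cos (angle x t k 0)).
  by apply/colP => k; rewrite !mxE.
have imV : map_mx Im (gen_voltage x t) =
    \col_k (amplitude x t k 0 * sin (angle x t k 0)).
  by apply/colP => k; rewrite !mxE.
split=> [[u /complex_network_equation[]]|H].
  move=> /(network_equation_kron P n_gt0)[+ _] /(network_equation_kron P n_gt0)[+ _].
  rewrite reE imE reV imV => /generator_voltage_part h1 /generator_voltage_part h2 i.
  have := h1 i; have := h2 i; rewrite !mxE => -> ->.
  by split; congr (_ * _); apply: eq_bigr => k _; congr (_ * _); rewrite mxE.
pose q := invmx (drsubmx (laplacian P)) *m (ursubmx (laplacian P))^T.
exists (- (map_mx (real_complex R) q *m gen_voltage x t)).
apply/complex_network_equation; split; apply/(network_equation_kron P n_gt0); split.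
- rewrite reE reV; apply/generator_voltage_part => i; rewrite mxE (H i).1.
  by congr (_ * _); apply: eq_bigr => k _; congr (_ * _); rewrite mxE.
- by rewrite -map_Re_mulmx; apply/matrixP => i j; rewrite !mxE; case: (\sum_(_ < _) _).
- rewrite imE imV; apply/generator_voltage_part => i; rewrite mxE (H i).2.
  by congr (_ * _); apply: eq_bigr => k _; congr (_ * _); rewrite mxE.
- by rewrite -map_Im_mulmx; apply/matrixP => i j; rewrite !mxE; case: (\sum_(_ < _) _).
Qed.

(** Expanding the sine exposes the two voltage components; substituting them cancels [chi i], and
    the sine formula applied backwards gives the Kron-reduced coupling. *)
Lemma electrical_power (x : trajectory R n nbar) (t : R) i :
  amplitude x t i 0 * cos (angle x t i 0) =
    chi i * \sum_k G i k * (E k 0 * cos (phase x t k 0)) ->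
  amplitude x t i 0 * sin (angle x t i 0) =
    chi i * \sum_k G i k * (E k 0 * sin (phase x t k 0)) ->
  E i 0 * amplitude x t i 0 / chi i * sin (phase x t i 0 - angle x t i 0) =
  \sum_k G i k * E i 0 * E k 0 * sin (phase x t i 0 - phase x t k 0).
Proof.
move=> hc hs; have chi0 : chi i != 0 by rewrite gt_eqF ?gen_reactance_gt0.
rewrite sinB.
transitivity (E i 0 / chi i *
  (sin (phase x t i 0) * (amplitude x t i 0 * cos (angle x t i 0)) -
   cos (phase x t i 0) * (amplitude x t i 0 * sin (angle x t i 0)))).
  by ring.
rewrite hc hs !(mulrCA _ (chi i)) -mulrBr mulrA divfK// !mulr_sumr -sumrB mulr_sumr.
by apply: eq_bigr => k _; rewrite sinB; ring.
Qed.

Lemma swing_equationE (x : trajectory R n nbar) (t : R) :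
  inertia_mx P *m acceleration x t + damping_mx P *m frequency x t =
    f - \col_i (E i 0 * amplitude x t i 0 / chi i *
            sin (phase x t i 0 - angle x t i 0)) <->
  forall i, M i * acceleration x t i 0 + D i * frequency x t i 0 =
    f i 0 - E i 0 * amplitude x t i 0 / chi i *
            sin (phase x t i 0 - angle x t i 0).
Proof.
split=> [/colP H i|H]; last apply/colP => i.
  by have := H i; rewrite !mul_diag_mx !mxE.
by rewrite !mul_diag_mx !mxE H.
Qed.

Lemma solution_voltage (x : trajectory R n nbar) : is_solution P x ->
  forall (t : R) i, 0 <= t ->
    amplitude x t i 0 * cos (angle x t i 0) =
      chi i * \sum_k G i k * (E k 0 * cos (phase x t k 0)) /\
    amplitude x t i 0 * sin (angle x t i 0) =
      chi i * \sum_k G i k * (E k 0 * sin (phase x t k 0)).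
Proof.
move=> sx t i t0; apply: (network_equation_polar x t).1.
by exists (nongen_voltage x t); exact: network_equation.
Qed.

Lemma solution_swing (x : trajectory R n nbar) : is_solution P x ->
  forall (t : R) i, 0 <= t ->
    M i * acceleration x t i 0 + D i * frequency x t i 0 =
    f i 0 - \sum_k G i k * E i 0 * E k 0 * sin (phase x t i 0 - phase x t k 0).
Proof.
move=> sx t i t0; have [hc hs] := solution_voltage sx i t0.
by rewrite -electrical_power// (swing_equationE x t).1//; exact: swing_equation.
Qed.

(** The Kron-reduced swing equation as a first-order field, with phases indexed by [inl] and
    frequencies by [inr]. *)
Definition swing_field (u : 'I_n + 'I_n -> R) (s : 'I_n + 'I_n) : R :=
  match s with
  | inl i => u (inr i)
  | inr i => (f i 0 - D i * u (inr i) -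
      \sum_k G i k * E i 0 * E k 0 * sin (u (inl i) - u (inl k))) / M i
  end.

Lemma swing_field_lipschitz : exists2 K : R, 0 < K &
  forall (u v : 'I_n + 'I_n -> R) e, (forall s, `|u s - v s| <= e) ->
    forall s, `|swing_field u s - swing_field v s| <= K * e.
Proof.
(* A Lipschitz constant for the frequency component [i]; the factor [2] comes from the two phases in
   each sine. *)
pose k i := (D i + \sum_k `|G i k * E i 0 * E k 0| * 2) / M i.
have k0 i : 0 <= k i.
  rewrite divr_ge0 ?(ltW (inertia_gt0 _ _))// addr_ge0 ?damping_ge0//.
  by apply: sumr_ge0 => j _; rewrite mulr_ge0.
exists (1 + \sum_i k i); first by rewrite ltr_pwDl// sumr_ge0.
move=> u v e uv s.
have e0 : 0 <= e by apply: le_trans (uv s).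
suff : `|swing_field u s - swing_field v s| <=
    match s with inl _ => 1 | inr i => k i end * e.
  move=> /le_trans; apply; apply: ler_wpM2r => //.
  case: s => i; first by rewrite lerDl sumr_ge0.
  rewrite (bigD1 i)//= addrCA lerDl addr_ge0// sumr_ge0//.
case: s => i /=; first by rewrite mul1r.
rewrite -mulrBl normrM normfV (gtr0_norm (inertia_gt0 _ _)) /k mulrAC.
apply: ler_wpM2r; first by rewrite invr_ge0 ltW// inertia_gt0.
rewrite [X in `|X|](_ : _ = - (D i * (u (inr i) - v (inr i))) -
  \sum_k (G i k * E i 0 * E k 0) *
     (sin (u (inl i) - u (inl k)) - sin (v (inl i) - v (inl k)))); last first.
  under [X in _ = _ - X]eq_bigr do rewrite mulrBr.
  by rewrite sumrB; ring.
apply: (le_trans (ler_normB _ _)); rewrite normrN mulrDl; apply: lerD.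
  by rewrite normrM (ger0_norm (damping_ge0 _ _)) ler_wpM2l// damping_ge0.
rewrite mulr_suml; apply: (le_trans (ler_norm_sum _ _ _)).
apply: ler_sum => j _; rewrite normrM -[leRHS]mulrA; apply: ler_wpM2l => //.
apply: (le_trans (sin_lipschitz _ _)).
rewrite opprD opprK addrACA mulr2n mulrDl mul1r.
by apply: (le_trans (ler_normD _ _)); apply: lerD => //; rewrite addrC distrC.
Qed.

Lemma solution_exists (delta0 omega0 : 'cV[R]_n) :
  exists x : trajectory R n nbar,
    [/\ is_solution P x, phase x 0 = delta0 & frequency x 0 = omega0].
Proof.
have [K K0 FK] := swing_field_lipschitz.
have [y [y0 dy]] := lipschitz_ode_solution K0 FK
  (fun s => match s with inl i => delta0 i 0 | inr i => omega0 i 0 end).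
have [a /choice[phi aphi]] := choice (fun z : R * R => polar_decomposition z.1 z.2).
pose vc t i := chi i * \sum_k G i k * (E k 0 * cos (y (inl k) t)).
pose vs t i := chi i * \sum_k G i k * (E k 0 * sin (y (inl k) t)).
(* The non-generator voltage [u] stays a parameter, because it is chosen from amplitudes and angles
   that do not depend on it. *)
pose x u : trajectory R n nbar := Trajectory
  (fun t => \col_i y (inl i) t) (fun t => \col_i y (inr i) t)
  (fun t => \col_i swing_field (y ^~ t) (inr i))
  (fun t => \col_i a (vc t i, vs t i)) (fun t => \col_i phi (vc t i, vs t i)) u.
have vcE u t i : amplitude (x u) t i 0 * cos (angle (x u) t i 0) =
      chi i * \sum_k G i k * (E k 0 * cos (phase (x u) t k 0)).
  have [_ h _] := aphi (vc t i, vs t i); rewrite /= !mxE h /vc.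
  by congr (_ * _); apply: eq_bigr => k _; congr (_ * _); rewrite mxE.
have vsE u t i : amplitude (x u) t i 0 * sin (angle (x u) t i 0) =
      chi i * \sum_k G i k * (E k 0 * sin (phase (x u) t k 0)).
  have [_ _ h] := aphi (vc t i, vs t i); rewrite /= !mxE h /vs.
  by congr (_ * _); apply: eq_bigr => k _; congr (_ * _); rewrite mxE.
have /choice[u uP] := fun t : R => (network_equation_polar (x (cst 0)) t).2
  (fun i => conj (vcE _ t i) (vsE _ t i)).
exists (x u); split; last 2 first.
- by apply/colP => i; rewrite mxE y0.
- by apply/colP => i; rewrite mxE y0.
split=> /=.
- move=> t i t0; rewrite mxE; have := dy t (inl i) t0.
  by apply: has_derivative_on_ge0_ext => // s _; rewrite mxE.
- move=> t i t0; rewrite mxE; have := dy t (inr i) t0.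
  by apply: has_derivative_on_ge0_ext => // s _; rewrite mxE.
- by move=> t i _; rewrite mxE; have [] := aphi (vc t i, vs t i).
- move=> t _; apply/(swing_equationE (x u)) => i.
  rewrite electrical_power; [|exact: vcE|exact: vsE].
  rewrite /= !mxE /= (mulrC (M i)) divfK ?gt_eqF ?inertia_gt0//.
  rewrite addrAC subrK; congr (_ - _).
  by apply: eq_bigr => k _; rewrite !mxE.
- by move=> t _; exact: uP.
Qed.

End Solutions.

(** * Synchronization and symmetry *)

Section Symmetry.
Variables (R : realType) (n : nat) (i j : 'I_n).

Lemma Sset_tperm (A : 'M[R]_n) :
  Sset i j A <-> forall k l, A (tperm i j k) (tperm i j l) = A k l.
Proof.
have E k l : (A *m tperm_mx i j) k l = A k (tperm i j l).
  by rewrite /tperm_mx -[tperm i j in LHS]tpermV -col_permE mxE.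
have E' k l : (tperm_mx i j *m A) k l = A (tperm i j k) l.
  by rewrite /tperm_mx -row_permE mxE.
rewrite /Sset/=; split=> [/matrixP H k l|H].
  by have := H k (tperm i j l); rewrite E E' tpermK => <-.
by apply/matrixP => k l; rewrite E E' -[RHS]H tpermK.
Qed.

Lemma Sset_diag (d : 'I_n -> R) :
  Sset i j (diag_mx (\row_k d k)) <-> d i = d j.
Proof.
rewrite Sset_tperm; split=> [/(_ i i)|H k l].
  by rewrite tpermL !mxE !eqxx !mulr1n => ->.
rewrite !mxE (inj_eq perm_inj); case: eqP => //= _.
by case: tpermP => [->|->|_ _] //; rewrite H.
Qed.

(** Reindexing by the transposition carries row [j] to row [i] and fixes [g]. *)
Lemma Sset_sum (A : 'M[R]_n) (g : 'I_n -> R) : Sset i j A -> g i = g j ->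
  \sum_k A i k * g k = \sum_k A j k * g k.
Proof.
move=> /Sset_tperm SA gij; rewrite [RHS](reindex_inj (@perm_inj _ (tperm i j)))/=.
apply: eq_bigr => k _; rewrite -{1}(tpermL i j) SA; congr (_ * _).
by case: tpermP => [->|->|].
Qed.

Lemma sum_eq_pair (p q : 'I_n -> R) : i != j ->
  (forall k, k != i -> k != j -> p k = q k) -> \sum_k p k = \sum_k q k ->
  p i + p j = q i + q j.
Proof.
move=> ij pq.
have split_sum (r : 'I_n -> R) : \sum_k r k =
    r i + r j + \sum_(k | (k != i) && (k != j)) r k.
  by rewrite (bigD1 i)//= (bigD1 j) 1?eq_sym//= addrA.
rewrite !split_sum (eq_bigr q) => [/addIr//|k /andP[ki kj]]; exact: pq.
Qed.

End Symmetry.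

(** * Synchronization of a single pair of generators *)

Section Synchronization.
Variables (R : realType) (n nbar : nat) (P : power_system R n nbar).
Hypothesis n_ge3 : (3 <= n)%N.
Variables (i j : 'I_n).
Hypothesis ij : i != j.
Hypothesis M_eq : inertia P i = inertia P j.
Notation G := (Gamma P).
Notation D := (damping P).
Notation f := (power_input P).
Notation E := (emf P).
Notation chi := (gen_reactance P).

Let n_gt0 : (0 < n)%N. Proof. exact: leq_trans n_ge3. Qed.
Let chi_gt0 k : 0 < chi k. Proof. exact: gen_reactance_gt0. Qed.
Let E_gt0 k : 0 < E k 0. Proof. exact: emf_gt0. Qed.
Let G_sym k l : G k l = G l k.
Proof. by rewrite -[in LHS](Gamma_tr P) mxE. Qed.

(** Equality of the phases for all [t >= 0] passes to frequencies and then to accelerations by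
    uniqueness of one-sided derivatives. Equal inertias then cancel the accelerations at time [0],
    leaving algebraic relations in freely chosen synchronous data. *)
Lemma synchronized_initial_balance (delta omega : 'cV[R]_n) :
  synchronized P i j -> delta i 0 = delta j 0 -> omega i 0 = omega j 0 ->
  [/\ D i * omega i 0 - D j * omega j 0 = f i 0 - f j 0 -
        (\sum_k G i k * E i 0 * E k 0 * sin (delta i 0 - delta k 0) -
         \sum_k G j k * E j 0 * E k 0 * sin (delta j 0 - delta k 0)),
      chi i * \sum_k G i k * (E k 0 * cos (delta k 0)) =
        chi j * \sum_k G j k * (E k 0 * cos (delta k 0)) &
      chi i * \sum_k G i k * (E k 0 * sin (delta k 0)) =
        chi j * \sum_k G j k * (E k 0 * sin (delta k 0))].
Proof.
move=> sync dij wij.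
have [x [sx x0 w0]] := solution_exists P n_gt0 delta omega.
have xs : forall t : R, 0 <= t ->
    phase x t i 0 = phase x t j 0 /\ gen_voltage x t i 0 = gen_voltage x t j 0.
  by apply: sync => //; rewrite /Xset/= ?x0 ?w0.
have ws (t : R) : 0 <= t -> frequency x t i 0 = frequency x t j 0.
  move=> t0; have dj := @phase_deriv _ _ _ _ _ sx t j t0.
  apply: (has_derivative_on_ge0_unique t0 _ dj).
  apply: (has_derivative_on_ge0_ext t0 _ (@phase_deriv _ _ _ _ _ sx t i t0)) => s s0.
  exact: (xs s s0).1.
have as_ : acceleration x 0 i 0 = acceleration x 0 j 0.
  have dj := @frequency_deriv _ _ _ _ _ sx 0 j (lexx 0).
  apply: (has_derivative_on_ge0_unique (lexx 0) _ dj).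
  exact: (has_derivative_on_ge0_ext (lexx 0) ws (@frequency_deriv _ _ _ _ _ sx 0 i (lexx 0))).
have hi := solution_swing n_gt0 sx i (lexx 0).
have hj := solution_swing n_gt0 sx j (lexx 0).
have [ci si] := solution_voltage n_gt0 sx i (lexx 0).
have [cj sj] := solution_voltage n_gt0 sx j (lexx 0).
have [_] := xs 0 (lexx 0); rewrite !mxE => -[Vc Vs].
rewrite x0 in hi hj ci si cj sj.
split; [|by rewrite -ci -cj|by rewrite -si -sj].
rewrite w0 M_eq as_ in hi; rewrite w0 in hj.
lra.
Qed.

Lemma synchronized_symmetric : synchronized P i j ->
  [/\ D i = D j, f i 0 = f j 0, E i 0 = E j 0 & Sset i j G].
Proof.
move=> sync.
have z_sin l : \sum_k G l k * E l 0 * E k 0 *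
    sin ((const_mx 0 : 'cV[R]_n) l 0 - (const_mx 0 : 'cV[R]_n) k 0) = 0.
  by apply: big1 => k _; rewrite !mxE subrr sin0 mulr0.
have constE c l : (const_mx c : 'cV[R]_n) l 0 = c by rewrite mxE.
have const_ij c : (const_mx c : 'cV[R]_n) i 0 = (const_mx c : 'cV[R]_n) j 0.
  by rewrite !mxE.
have [h0 hE _] := synchronized_initial_balance sync (const_ij 0) (const_ij 0).
rewrite !z_sin !constE !mulr0 !subr0 in h0.
have fij : f i 0 = f j 0 by lra.
have cosE l : \sum_k G l k * (E k 0 * cos ((const_mx 0 : 'cV[R]_n) k 0)) =
    \sum_k G l k * E k 0.
  by apply: eq_bigr => k _; rewrite constE cos0 mulr1.
(* With equal phases and unit frequencies, only the damping terms survive. *)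
have [h1 _ _] := synchronized_initial_balance sync (const_ij 0) (const_ij 1).
rewrite !z_sin !constE !mulr1 !subr0 in h1.
have Dij : D i = D j by lra.
have hk k : k != i -> k != j ->
    G i k * E i 0 = G j k * E j 0 /\ chi i * G i k = chi j * G j k.
  (* Only generator [k] has a nonzero phase, with sine [1], so for rows [i] and [j] each sine sum
     collapses to its column [k] term. *)
  move=> ki kj; pose d : 'cV[R]_n := \col_l if l == k then pi / 2 else 0.
  have d0 l : l != k -> d l 0 = 0 by move=> lk; rewrite mxE (negPf lk).
  have dk : d k 0 = pi / 2 by rewrite mxE eqxx.
  have dij : d i 0 = d j 0 by rewrite !d0// eq_sym.
  have [h2 _ h3] := synchronized_initial_balance sync dij (const_ij 0).
  have s1 l : l != k -> \sum_m G l m * E l 0 * E m 0 * sin (d l 0 - d m 0) =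
      - (G l k * E l 0 * E k 0).
    move=> lk; rewrite (bigD1 k)//= big1 => [|m mk].
      by rewrite dk d0// sub0r sinN sin_pihalf addr0 mulrN1.
    by rewrite !d0// subrr sin0 mulr0.
  have s2 l : \sum_m G l m * (E m 0 * sin (d m 0)) = G l k * E k 0.
    rewrite (bigD1 k)//= big1 => [|m mk]; first by rewrite dk sin_pihalf mulr1 addr0.
    by rewrite d0// sin0 !mulr0.
  rewrite !s1 1?eq_sym// !constE !mulr0 in h2; rewrite !s2 in h3.
  have Ek := lt0r_neq0 (E_gt0 k).
  split; last by apply: (mulIf Ek); rewrite -!mulrA.
  by apply: (mulIf Ek); lra.
have row_sum k : chi k * \sum_l G k l = 1.
  by rewrite Gamma_row_sum// divff// gt_eqF.
have hsum : chi i * G i i + chi i * G i j = chi j * G j i + chi j * G j j.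
  apply: (@sum_eq_pair _ _ i j (fun k => chi i * G i k) (fun k => chi j * G j k)) => //.
    by move=> k ki kj; exact: (hk k ki kj).2.
  by rewrite -!mulr_sumr !row_sum.
(* The relation [hE], from the voltages at zero phases, gives a second equation with weights [E]. *)
have hsumE : chi i * G i i * E i 0 + chi i * G i j * E j 0 =
    chi j * G j i * E i 0 + chi j * G j j * E j 0.
  apply: (@sum_eq_pair _ _ i j (fun k => chi i * G i k * E k 0)
    (fun k => chi j * G j k * E k 0)) => //.
    by move=> k ki kj; rewrite (hk k ki kj).2.
  under eq_bigr do rewrite -mulrA.
  under [RHS]eq_bigr do rewrite -mulrA.
  by rewrite -!mulr_sumr -!cosE.
(* Writing a, b and c, d for the entries i, j of the rows chi_i Gamma_i and
   chi_j Gamma_j: a + b = c + d and a E_i + b E_j = c E_i + d E_j, so either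
   E_i = E_j or these rows coincide, contradicting invertibility of Gamma. *)
have Eij : E i 0 = E j 0.
  have Gij : chi i * G i j = chi j * G j i + chi j * G j j - chi i * G i i by lra.
  have /eqP : (chi i * G i i - chi j * G j i) * (E i 0 - E j 0) = 0.
    by rewrite Gij in hsumE; lra.
  rewrite mulf_eq0 !subr_eq0 => /orP[/eqP h|/eqP//]; exfalso.
  pose u : 'rV[R]_n := chi i *: delta_mx 0 i - chi j *: delta_mx 0 j.
  have uG : u *m G = 0.
    have combE (A : 'M[R]_n) k : (chi i *: row i A - chi j *: row j A) 0 k =
        chi i * A i k - chi j * A j k by rewrite !mxE.
    rewrite mulmxBl -!scalemxAl -!rowE; apply/rowP => k; rewrite combE [RHS]mxE.
    have [->|ki] := eqVneq k i; first by rewrite h subrr.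
    have [->|kj] := eqVneq k j; first by lra.
    by rewrite (hk k ki kj).2 subrr.
  have : u 0 i = 0.
    by rewrite -[u](mulmxK (Gamma_unit P n_gt0)) uG mul0mx mxE.
  rewrite !mxE !eqxx (negPf ij) mulr1 mulr0 subr0 => chi0.
  by have := chi_gt0 i; rewrite chi0 ltxx.
have Gk k : k != i -> k != j -> G i k = G j k.
  move=> ki kj; apply: (mulIf (lt0r_neq0 (E_gt0 i))).
  by rewrite (hk k ki kj).1 Eij.
(* Otherwise Gamma is block diagonal for {i, j} and its complement, so the
   indicator of {i, j} lies in the kernel of the Kron-reduced Laplacian; it is
   not constant since n >= 3. *)
have chi_eq : chi i = chi j.
  apply: contrapT => chiN.
  have G0 k : k != i -> k != j -> G i k = 0.
    move=> ki kj; have [_ /eqP] := hk k ki kj; rewrite -(Gk k)// -subr_eq0 -mulrBl.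
    by rewrite mulf_eq0 subr_eq0 => /orP[/eqP//|/eqP].
  have [k /andP[ki kj]] : exists k : 'I_n, (k != i) && (k != j).
    apply: contrapT => H; have : (#|'I_n| <= #|pred2 i j|)%N.
      apply: subset_leq_card; apply/fintype.subsetP => k _; apply: contrapT => kij.
      by apply: H; exists k; rewrite -negb_or; apply/negP.
    by rewrite card_ord card2 ij => /(leq_trans n_ge3).
  pose v : 'cV[R]_n := \col_l ((l == i) || (l == j))%:R.
  have vE l : v l 0 = ((l == i) || (l == j))%:R by rewrite mxE.
  have Gv l : (G *m v) l 0 = G l i + G l j.
    rewrite mxE (bigD1 i)//= (bigD1 j) 1?eq_sym//= big1 => [|m /andP[mi mj]].
      by rewrite !vE !eqxx orbT addr0 !mulr1.
    by rewrite vE (negPf mi) (negPf mj) mulr0.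
  have Gsum l : l = i \/ l = j -> G l i + G l j = (chi l)^-1.
    move=> lij; rewrite -(Gamma_row_sum P n_gt0 l).
    rewrite (bigD1 i)//= (bigD1 j) 1?eq_sym//= big1 ?addr0// => m /andP[mi mj].
    by case: lij => ->; [exact: G0|rewrite -Gk// G0].
  have /(Gamma_fixE P n_gt0)/(kron_ker_const n_gt0)/(_ i k) : G *m v = LD_mx P *m v.
    apply/colP => l; rewrite Gv LD_diagE vE.
    have [li|li] := eqVneq l i; first by rewrite mulr1 Gsum//; left.
    have [lj|lj] := eqVneq l j; first by rewrite mulr1 Gsum//; right.
    by rewrite mulr0 !(G_sym l) -(Gk l)// G0// addr0.
  by rewrite !vE eqxx (negPf ki) (negPf kj)/= => /eqP; rewrite oner_eq0.
have Gii : G i i = G j j.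
  apply: (mulfI (lt0r_neq0 (chi_gt0 i))).
  by move: hsum; rewrite chi_eq (G_sym j i); lra.
(* Entries with both indices in the pair use [Gii] and [G_sym], those with exactly one use [Gk], and
   the others are fixed. *)
split=> //; apply/Sset_tperm => k l.
case: (tpermP i j k) => [->|->|/eqP ki /eqP kj];
  case: (tpermP i j l) => [->|->|/eqP li /eqP lj] //; try by rewrite Gk.
- by rewrite !(G_sym k) Gk.
- by rewrite !(G_sym k) Gk.
Qed.

(** Transposing the summation index for generator [j] gives it the coefficients of generator [i].
    The acceleration difference is then bounded by the phase and frequency differences, which forces
    the phases to agree; the voltages follow by the same symmetry. *)
Lemma symmetric_synchronized :
  D i = D j -> f i 0 = f j 0 -> E i 0 = E j 0 -> Sset i j G ->
  synchronized P i j.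
Proof.
move=> Dij fij Eij SG x sx; rewrite /Xset/= => p0 w0 t t0.
have G_tperm := (Sset_tperm i j G).1 SG.
have E_tperm k : E (tperm i j k) 0 = E k 0 by case: tpermP => [->|->|].
have M_gt0 := inertia_gt0 P i.
pose C := (\sum_k `|G i k * E i 0 * E k 0| * 2 + D i) / inertia P i.
have C1 : \sum_k `|G i k * E i 0 * E k 0| * 2 <= \sum_k `|G i k * E i 0 * E k 0| * 2 + D i.
  by rewrite lerDl damping_ge0.
have C2 : D i <= \sum_k `|G i k * E i 0 * E k 0| * 2 + D i.
  by rewrite lerDr sumr_ge0// => k _; rewrite mulr_ge0.
have phase_eq (s : R) : 0 <= s -> phase x s i 0 = phase x s j 0.
  move=> s0; apply/eqP; rewrite -subr_eq0; apply/eqP; move: s s0.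
  apply: (@second_order_zero R
    ((fun s => phase x s i 0) \- (fun s => phase x s j 0))
    ((fun s => frequency x s i 0) \- (fun s => frequency x s j 0))
    (fun s => acceleration x s i 0 - acceleration x s j 0) C).
  - by move=> s s0; apply: has_derivative_on_ge0B; exact: (phase_deriv sx).
  - by move=> s s0; apply: has_derivative_on_ge0B; exact: (frequency_deriv sx).
  - move=> s s0.
    have hi := solution_swing n_gt0 sx i s0.
    have := solution_swing n_gt0 sx j s0.
    rewrite (reindex_inj (@perm_inj _ (tperm i j)))/= => hj.
    set S := \sum_k G i k * E i 0 * E k 0 * (sin (phase x s i 0 - phase x s k 0) -
      sin (phase x s j 0 - phase x s (tperm i j k) 0)).
    rewrite /=; have SE : inertia P i * (acceleration x s i 0 - acceleration x s j 0) =
        - S - D i * (frequency x s i 0 - frequency x s j 0).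
      have -> : S = \sum_k G i k * E i 0 * E k 0 * sin (phase x s i 0 - phase x s k 0) -
          \sum_k G j (tperm i j k) * E j 0 * E (tperm i j k) 0 *
            sin (phase x s j 0 - phase x s (tperm i j k) 0).
        rewrite -sumrB; apply: eq_bigr => k _.
        by rewrite mulrBr -Eij E_tperm -{3}(tpermL i j) G_tperm.
      by rewrite -Dij -fij -M_eq in hj; lra.
    rewrite /C mulrAC ler_pdivlMr// mulrC -[X in X * _](gtr0_norm M_gt0) -normrM SE.
    apply: (le_trans (ler_normB _ _)); rewrite normrN [leRHS]mulrDr; apply: lerD.
      apply: le_trans (ler_wpM2r (normr_ge0 _) C1).
      rewrite mulr_suml; apply: (le_trans (ler_norm_sum _ _ _)).
      apply: ler_sum => k _; rewrite normrM -[leRHS]mulrA; apply: ler_wpM2l => //.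
      apply: (le_trans (sin_lipschitz _ _)).
      pose d := `|phase x s i 0 - phase x s j 0|.
      have d0 : 0 <= d by rewrite normr_ge0.
      rewrite -/d.
      (* The sine arguments differ by nothing for [k = i], by twice the phase difference for
         [k = j], and by the phase difference itself otherwise. *)
      case: tpermP => [->|->|_ _]; first by rewrite !subrr normr0 mulr_ge0.
        rewrite -(opprB (phase x s i 0) (phase x s j 0)) opprK.
        by apply: (le_trans (ler_normD _ _)); rewrite -/d; lra.
      by rewrite opprB addrA subrK -/d; lra.
    apply: le_trans (ler_wpM2r (normr_ge0 _) C2).
    by rewrite normrM ger0_norm// damping_ge0.
  - by rewrite /= p0 subrr.
  - by rewrite /= w0 subrr.
split; first exact: phase_eq.
(* Rows exchanged by the symmetry have equal sums, and these are the inverse reactances. *)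
have chi_eq : chi i = chi j.
  apply: invr_inj; rewrite -!(Gamma_row_sum P n_gt0).
  have := @Sset_sum _ _ i j G (fun=> 1) SG erefl.
  by under eq_bigr do rewrite mulr1; under [RHS]eq_bigr do rewrite mulr1.
have [ci si] := solution_voltage n_gt0 sx i t0.
have [cj sj] := solution_voltage n_gt0 sx j t0.
rewrite !mxE ci si cj sj chi_eq.
by congr (_ +i* _)%C; congr (_ * _); apply: Sset_sum => //; rewrite Eij phase_eq.
Qed.

End Synchronization.

Theorem theorem10 (R : realType) (n nbar : nat) (hn : (3 <= n)%N)
    (P : power_system R n nbar) (I : {set {set 'I_n}})
    (hI : finset.partition I (finset.setTfor 'I_n))
    (hM : Scl I (inertia_mx P)) :
  strongly_synchronized P I <->
  [/\ Scl I (damping_mx P), Xcl I (power_input P), Xcl I (emf P) &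
      Scl I (Gamma P)].
Proof.
have M_eq C i j : C \in I -> i \in C -> j \in C -> inertia P i = inertia P j.
  by move=> CI iC jC; apply/(Sset_diag i j (inertia P)); exact: (hM C).
split=> [sync|[SD Xf XE SG] C i j CI iC jC].
  have sym C i j : C \in I -> i \in C -> j \in C ->
      [/\ damping P i = damping P j, power_input P i 0 = power_input P j 0,
          emf P i 0 = emf P j 0 & Sset i j (Gamma P)].
    (* The pairwise result concerns distinct generators; for [i = j] the transposition is the
       identity. *)
    move=> CI iC jC; have [<-|ij] := eqVneq i j.
      by split=> //; apply/Sset_tperm => k l; rewrite tperm1 !perm1.
    exact: (synchronized_symmetric hn ij (M_eq C i j CI iC jC)
      (sync C i j CI iC jC)).
  split=> C i j CI iC jC; have [SD Xf XE SG] := sym C i j CI iC jC => //.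
  by apply/Sset_diag.
have [<-|ij] := eqVneq i j; first by move=> x _ _ _ t _.
apply: symmetric_synchronized => //.
- exact: M_eq CI iC jC.
- by apply/(Sset_diag i j (damping P)); exact: (SD C).
- exact: (Xf C).
- exact: (XE C).
- exact: (SG C).
Qed.
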